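(* For every integer $k\ge 2$ and every positive integer $n$, \[ \mathrm{ex}^{\mathrm{lin}}_3\big(n, C^{(3)}_{2k+1}\big)\le 2k\,n^{1+1/k}+9kn. \]
   Context: A 3-uniform hypergraph is linear if any two distinct hyperedges share at most one vertex. A Berge cycle of length $m$ is a family of $m$ distinct hyperedges $H_0,\dots,H_{m-1}$ for which there exist distinct vertices $v_0,\dots,v_{m-1}$ with $\{v_i,v_{i+1}\}\subset H_i$ for $0\le i\le m-1$ (indices mod $m$). $\mathrm{ex}^{\mathrm{lin}}_3(n,C^{(3)}_m)$ is the maximum number of hyperedges in a 3-uniform linear hypergraph on $n$ vertices containing no Berge cycle of length $m$. *)

(* Defs.v *)
From HB Require Import structures.
From mathcomp Require Import all_boot.
From Stdlib Require Import Reals.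
Set Implicit Arguments. Unset Strict Implicit. Unset Printing Implicit Defensive.

Definition uniform3 (n : nat) (E : {set {set 'I_n}}) : bool :=
  [forall e in E, #|e| == 3].

Definition linear_hg (n : nat) (E : {set {set 'I_n}}) : bool :=
  [forall e1 in E, forall e2 in E, (e1 != e2) ==> (#|e1 :&: e2| <= 1)].

Definition has_berge_cycle (n m : nat) (E : {set {set 'I_n}}) : bool :=
  [exists H : {ffun 'I_m -> {set 'I_n}},
    exists v : {ffun 'I_m -> 'I_n},
      [&& injectiveb H, injectiveb v &
          [forall i : 'I_m,
             [&& H i \in E, v i \in H i & v (ordS i) \in H i]]]].

Definition ex_lin3 (n m : nat) : nat :=
  \max_(E : {set {set 'I_n}} |
          [&& uniform3 E, linear_hg E & ~~ has_berge_cycle m E]) #|E|.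

(* Main.v *)
(* Let |E| exceed the bound. Deleting vertices of small degree leaves a linear
   hypergraph of minimum degree d >= 2k n^(1/k) + 9k; take breadth-first levels
   V_0, ..., V_k from a vertex, joining each vertex to its parent by a tree
   hyperedge.

   The hyperedges outside the tree with two vertices in V_i form a graph on V_i.
   If it had more than (2k-1)|V_i| edges, some subgraph W would have minimum
   degree 2k, so that paths in W extend greedily. Let s be the last level at which
   the two ends of every edge of W have the same ancestor. If some edge of W has
   ends branching after level s through distinct tree hyperedges, then so do the
   ends of a path in W of the odd length 2(k-i+s)+1, and the tree closes it to a
   cycle of length 2k+1. Otherwise both branches always hang from one tree
   hyperedge, and closing a path of even length 2(k-i+s+1) works unless the
   branches alternate along W. In that case take an edge uv of W and the third
   vertex z of its hyperedge: a path of W from u or v (whichever has the right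
   parity), prolonged by z, is closed by the tree.

   Counting degrees over V_i then bounds d|V_i| by
   (2k-1)|V_(i-1)| + (6k-1)|V_i| + 2k|V_(i+1)|. To get the coefficient 2k, the tree
   hyperedge of a vertex is chosen to meet the previous level in one vertex only
   whenever possible. Hence |V_(i+1)| > n^(1/k) |V_i| and |V_k| > n. *)

Require Import Defs.
From mathcomp Require Import all_boot zify.
From Stdlib Require Import Reals Lra.
Set Implicit Arguments. Unset Strict Implicit. Unset Printing Implicit Defensive.

(* zify is very slow on contexts with many boolean hypotheses. *)
Ltac nlia :=
  repeat match goal with
  | H : ?P |- _ =>
    lazymatch type of P with Prop =>
      lazymatch P with
      | is_true (leq _ _) => fail
      | is_true (andb (leq _ _) (leq _ _)) => fail
      | @eq ?T _ _ => tryif unify T nat then fail else clear H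
      | _ => clear H
      end
    end
  end; lia.

(** * Paths and colourings in graphs of large minimum degree *)

Section MinDegreeGraph.
Variables (T : finType) (r : rel T) (W : {set T}) (d : nat).
Hypothesis r_sym : symmetric r.
Hypothesis r_irr : irreflexive r.
Hypothesis r_W : forall x y, r x y -> y \in W.
Hypothesis r_deg : forall x, x \in W -> d <= #|[set y | r x y]|.

(** Each step moves the current vertex into the forbidden set [F], so [l + #|F|] stays constant;
    while it is at most [d], some neighbour lies outside [F]. *)
Lemma greedy_path l (F : {set T}) x :
  x \in W -> x \notin F -> l + #|F| <= d ->
  exists p, [/\ size p = l, path r x p, uniq (x :: p) & all [predC F] p].
Proof.
elim: l F x => [|l IH] F x xW xF hd; first by exists [::].
have [y yN yF] : exists2 y, r x y & y \notin F.
  have /subsetPn[y] : ~~ ([set y | r x y] \subset F).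
    apply/negP=> /subset_leq_card; have := r_deg xW; lia.
  by rewrite inE => ? ?; exists y.
have yx : y != x by apply: contraTneq yN => ->; rewrite r_irr.
have [|||p [sp pp up ap]] := IH (x |: F) y; first exact: r_W yN.
- by rewrite !inE negb_or yx.
- by rewrite cardsU1 xF; lia.
have xp : x \notin p.
  by apply/negP=> /(allP ap) /=; rewrite !inE eqxx.
exists (y :: p); split => //=; first by rewrite sp.
- by rewrite yN.
- by rewrite inE negb_or eq_sym yx xp.
- rewrite yF /=; apply/allP => z /(allP ap) /=.
  by rewrite !inE negb_or => /andP[].
Qed.

Variables (C : eqType) (col : T -> C).

(** A path of length [m - 1] from [v] that avoids [x] and [y] can be prolonged backwards to either
    of them; both paths of length [m] have the same last vertex. *)
Lemma monochromatic_nbrs m : 0 < m -> m < d ->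
  (forall x p, path r x p -> uniq (x :: p) -> size p = m ->
     col (last x p) = col x) ->
  forall v x y, r v x -> r v y -> col x = col y.
Proof.
move=> m0 md hm v x y vx vy.
have vW : v \in W by apply: (@r_W x); rewrite r_sym.
have ne z : r v z -> v != z by apply: contraTneq => <-; rewrite r_irr.
have [||p [sp pp up ap]] := @greedy_path m.-1 [set x; y] v vW.
- by rewrite !inE negb_or !ne.
- by have := cards2 x y; case: (x != y) => /= ->; lia.
have key z : z \in [set x; y] -> r v z -> col (last v p) = col z.
  move=> zF vz; apply: (hm z (v :: p)).
  - by rewrite /= r_sym vz.
  - rewrite cons_uniq up andbT inE negb_or eq_sym ne //=.
    by apply/negP => /(allP ap) /=; rewrite zF.
  - by rewrite /= sp prednK.
by rewrite -(key x) ?(key y) // !inE eqxx ?orbT.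
Qed.

Lemma monochromatic_even_path : (forall v x y, r v x -> r v y -> col x = col y) ->
  forall p v, path r v p -> ~~ odd (size p) -> col (last v p) = col v.
Proof.
move=> hn p; have [n] := ubnP (size p).
elim: n p => // n IH [|x [|y p]] //= hs v /and3P[vx xy yp]; rewrite negbK => ev.
rewrite IH //; last by lia.
by apply: (hn x) => //; rewrite r_sym.
Qed.

(** A path of length [m] starting with the edge [uv] leaves an even path from [v]. Its end has the
    colour of [v] by [monochromatic_even_path] and that of [u] by hypothesis. *)
Lemma monochromatic_edges m : odd m -> m < d ->
  (forall x p, path r x p -> uniq (x :: p) -> size p = m ->
     col (last x p) = col x) ->
  forall u v, r u v -> col u = col v.
Proof.
move=> om md hm u v uv.
have m0 : 0 < m by case: (m) om.
have hn := monochromatic_nbrs m0 md hm.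
have uv' : v != u by apply: contraTneq uv => ->; rewrite r_irr.
have [|||p [sp pp up ap]] := @greedy_path m.-1 [set u] v; first exact: r_W uv.
- by rewrite inE.
- by rewrite cards1; lia.
have <- : col (last v p) = col u.
  apply: (hm u (v :: p)) => /=; rewrite ?uv ?sp ?prednK // -cons_uniq.
  rewrite cons_uniq up andbT inE negb_or eq_sym uv' /=.
  by apply/negP => /(allP ap) /=; rewrite inE eqxx.
by apply: (monochromatic_even_path hn pp); rewrite sp; lia.
Qed.

End MinDegreeGraph.

(* Delete vertices of low degree: a minimal nonempty vertex set keeping the
   edge/vertex density works. *)
Lemma min_degree_subset (T I : finType) (phi : I -> {set T}) (G : {set I})
    (U : {set T}) (p q : nat) :
  0 < p -> U != set0 -> (forall e, e \in G -> phi e \subset U) ->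
  (forall e, e \in G -> 1 < #|phi e|) -> p * #|U| <= q * #|G| ->
  exists2 S : {set T}, S \subset U /\ S != set0 &
    forall x, x \in S ->
      p < q * #|[set e in G | (phi e \subset S) && (x \in phi e)]|.
Proof.
move=> p0 U0 GU G2 hd.
pose GS (S : {set T}) := [set e in G | phi e \subset S].
pose dense (S : {set T}) :=
  [&& S != set0, S \subset U & p * #|S| <= q * #|GS S|].
have dU : dense U.
  rewrite /dense U0 subxx /=; suff -> : GS U = G by [].
  apply/setP => e; rewrite inE; case: (boolP (e \in G)) => //= eG.
  exact: GU.
have [S /minsetP[/and3P[S0 SU hS] minS] _] := minset_exists dU.
exists S; first by split.
move=> x xS.
set D := [set e in G | _].
have cS : #|S :\ x|.+1 = #|S| by rewrite (cardsD1 x S) xS.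
have sub : D \subset GS S.
  by apply/subsetP => e; rewrite !inE => /and3P[-> ->].
have eqGS : GS (S :\ x) = GS S :\: D.
  apply/setP => e; rewrite !inE subsetD1.
  by case: (e \in G); case: (phi e \subset S); case: (x \in phi e).
have cG : #|GS (S :\ x)| + #|D| = #|GS S|.
  by rewrite eqGS cardsD (setIidPr sub) subnK // subset_leq_card.
(* If [S] is the singleton of [x], no [phi e] fits in it, which contradicts density. Otherwise
   [S :\ x] is not dense by minimality, and comparing the two counts bounds the degree of [x]. *)
have [Sx0|Sx0] := eqVneq (S :\ x) set0.
  have : GS S = set0.
    apply/setP => e; rewrite !inE; apply/negP => /andP[eG eS].
    have := G2 e eG; rewrite ltnNge => /negP; apply.
    apply: leq_trans (subset_leq_card eS) _.
    by rewrite -cS Sx0 cards0.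
  move=> GS0; move: hS; rewrite GS0 cards0 -cS Sx0 cards0; lia.
have : ~~ dense (S :\ x).
  apply/negP => /minS /(_ (subsetDl _ _)) h.
  by move: xS; rewrite -h !inE eqxx.
rewrite /dense Sx0 (subset_trans (subsetDl _ _) SU) /= -ltnNge => h.
move: hS; rewrite -cG -cS; move: h; set a := #|_|; set b := #|D|; set s := #|_|.
nia.
Qed.

(** * Breadth-first trees and Berge cycles *)

(* A Berge walk is a list of pairs (vertex, hyperedge by which it is entered). *)
Definition berge_step n (E : {set {set 'I_n}}) : rel ('I_n * {set 'I_n}) :=
  fun a b => [&& b.2 \in E, a.1 \in b.2 & b.1 \in b.2].

(** A step reads only the vertex of its source and the hyperedge of its target, so walks can be
    glued at a common vertex. *)
Lemma berge_path_start n (E : {set {set 'I_n}}) a b p :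
  a.1 = b.1 -> path (berge_step E) a p = path (berge_step E) b p.
Proof. by case: p => //= c p eab; rewrite /berge_step eab. Qed.

Lemma has_berge_cycle_seq n (E : {set {set 'I_n}}) (c : seq ('I_n * {set 'I_n})) m :
  0 < m -> size c = m -> cycle (berge_step E) c ->
  uniq (unzip1 c) -> uniq (unzip2 c) -> has_berge_cycle m E.
Proof.
case: c => [|a c] m0 sc cyc u1 u2; first by move: m0; rewrite -sc.
(* An entry stores the hyperedge by which its vertex is entered, so the hyperedge joining vertices
   [i] and [i + 1] is read at [ordS i]. *)
apply/existsP; exists [ffun i : 'I_m => (nth a (a :: c) (ordS i)).2].
apply/existsP; exists [ffun i : 'I_m => (nth a (a :: c) i).1].
have lt (i : 'I_m) : i < size (a :: c) by rewrite sc.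
have inj T (f : 'I_n * {set 'I_n} -> T) (i j : 'I_m) :
    (forall i j, i < size (a :: c) -> j < size (a :: c) ->
       f (nth a (a :: c) i) = f (nth a (a :: c) j) -> i = j) ->
    f (nth a (a :: c) i) = f (nth a (a :: c) j) -> i = j.
  by move=> h /(h _ _ (lt i) (lt j)) /val_inj.
apply/and3P; split.
- apply/injectiveP => i j; rewrite !ffunE => h; apply: ordS_inj.
  apply: (inj _ snd) h => {}i {}j hi hj h.
  apply/eqP; rewrite -(nth_uniq set0 _ _ u2) ?size_map //.
  by rewrite !(nth_map a) // h.
- apply/injectiveP => i j; rewrite !ffunE; apply: (inj _ fst) => {}i {}j hi hj h.
  apply/eqP; rewrite -(nth_uniq a.1 _ _ u1) ?size_map //.
  by rewrite !(nth_map a) // h.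
apply/forallP => i; rewrite !ffunE.
have /(pathP a) /(_ i) : path (berge_step E) a (rcons c a) by [].
rewrite size_rcons => /(_ (lt i)).
have -> : nth a (a :: rcons c a) i = nth a (a :: c) i.
  by rewrite -rcons_cons nth_rcons lt.
have -> : nth a (rcons c a) i = nth a (a :: c) (ordS i).
  have -> : nat_of_ord (ordS i) = i.+1 %% m by [].
  rewrite nth_rcons; move: (ltn_ord i) => im; rewrite /= in sc.
  have [ic|ic] := ltnP i (size c).
    by rewrite modn_small //; nlia.
  have -> : nat_of_ord i = size c by nlia.
  by rewrite eqxx sc modnn.
by rewrite /berge_step => /and3P[-> -> ->].
Qed.

Section Tree.
Variables (n k : nat) (E : {set {set 'I_n}}) (x0 : 'I_n).
Variables (lev : 'I_n -> nat) (par : 'I_n -> 'I_n) (te : 'I_n -> {set 'I_n}).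

(* [lev] is the distance from the root [x0], capped at [k + 1]; a vertex [w] at
   level at most [k] is joined to its parent [par w] by the hyperedge [te w]. *)
Record bfs_tree : Prop := BfsTree {
  bfs_lev : forall e u v, e \in E -> u \in e -> v \in e -> lev v <= (lev u).+1;
  bfs_root : forall w, lev w = 0 -> w = x0;
  bfs_par : forall w, 0 < lev w <= k ->
    [/\ te w \in E, w \in te w, par w \in te w & (lev (par w)).+1 = lev w] }.

Hypothesis E3 : forall e, e \in E -> #|e| = 3.
Hypothesis E_lin : forall e1 e2 x y, e1 \in E -> e2 \in E -> x != y ->
  x \in e1 -> y \in e1 -> x \in e2 -> y \in e2 -> e1 = e2.
Hypothesis bfs : bfs_tree.

(** The ancestor at level [j]; truncated subtraction makes it [w] itself when [lev w <= j]. *)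
Definition anc j w := iter (lev w - j) par w.

Lemma anc_id j w : lev w <= j -> anc j w = w.
Proof. by rewrite /anc -subn_eq0 => /eqP ->. Qed.

Lemma anc_par j w : j < lev w -> anc j w = par (anc j.+1 w).
Proof. by move=> h; rewrite /anc subnS -iterS prednK // subn_gt0. Qed.

Lemma lev_anc j w : lev w <= k -> j <= lev w -> lev (anc j w) = j.
Proof.
move=> wk jw; rewrite -(subKn jw); move: (lev w - j) (leq_subr j (lev w)) => t.
elim: t => [|t IH] ht; first by rewrite subn0 anc_id.
have h := IH (ltnW ht); rewrite anc_par; last by nlia.
have -> : (lev w - t.+1).+1 = lev w - t by nlia.
have [] := @bfs_par bfs (anc (lev w - t) w); first by rewrite h; nlia.
by rewrite h => _ _ _; nlia.
Qed.

Lemma anc_eq_down l j x y : l <= j -> j <= lev x -> j <= lev y ->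
  anc j x = anc j y -> anc l x = anc l y.
Proof.
move=> lj jx jy; rewrite -(subKn lj); move: (j - l) (leq_subr l j) => t.
elim: t => [|t IH] ht h; first by rewrite subn0.
rewrite anc_par 1?[RHS]anc_par; try by nlia.
have -> : (j - t.+1).+1 = j - t by nlia.
by rewrite IH // ltnW.
Qed.

Lemma anc_root x y : lev x <= k -> lev y <= k -> anc 0 x = anc 0 y.
Proof.
by move=> xk yk; rewrite (bfs_root bfs (lev_anc xk _)) // (bfs_root bfs (lev_anc yk _)).
Qed.

Lemma te_lev w z : 0 < lev w <= k -> z \in te w -> lev z = lev w \/ lev z = (lev w).-1.
Proof.
move=> wk zw; have [teE ww pw lp] := bfs_par bfs wk.
have := bfs_lev bfs teE ww zw; have := bfs_lev bfs teE zw ww.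
have := bfs_lev bfs teE pw zw; nlia.
Qed.

(** A tree hyperedge lies on two consecutive levels, which fixes the level of [w]. Different parents
    would give four distinct vertices in a triple. *)
Lemma te_eq w w' : 0 < lev w <= k -> 0 < lev w' <= k -> te w = te w' ->
  lev w = lev w' /\ par w = par w'.
Proof.
move=> wk wk' ett; have [teE ww pw lp] := bfs_par bfs wk.
have [_ ww' pw' lp'] := bfs_par bfs wk'.
have l1 : lev w = lev w'.
  have := te_lev wk; rewrite ett => h1; have := te_lev wk'; rewrite -ett => h2.
  by have := h1 _ ww'; have := h2 _ ww; have := h1 _ pw'; have := h2 _ pw; nlia.
split=> //; have [eww'|ne] := eqVneq w w'; first by rewrite eww'.
apply/eqP; apply: contraTT isT => nep; have := E3 teE; rewrite -ett in pw' ww'.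
have dw x y : lev x != lev y -> x != y by apply: contraNneq => ->.
have : uniq [:: w; w'; par w; par w'].
  by rewrite /= !inE !negb_or ne nep !dw //; nlia.
move/card_uniqP => /= h4 h3.
have : #|[:: w; w'; par w; par w']| <= #|te w|.
  apply: subset_leq_card; apply/subsetP => z; rewrite !inE.
  by case/or4P => /eqP ->.
by rewrite h4 h3.
Qed.

(** Both cross the tree hyperedge between levels [l - 1] and [l]: the climb from [x] enters level
    [l - 1], the descent to [y] enters level [l]. *)
Definition up_entry x l := (anc l.-1 x, te (anc l x)).
Definition down_entry y l := (anc l y, te (anc l y)).

Lemma up_pathP x t l0 a : lev x <= k -> 0 < l0 -> l0 + t = (lev x).+1 -> a.1 = x ->
  path (berge_step E) a (rev (map (up_entry x) (iota l0 t))) /\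
  (last a (rev (map (up_entry x) (iota l0 t)))).1 = anc l0.-1 x.
Proof.
move=> xk + + ax; elim: t l0 => [|t IH] l0 l00 ht.
  by split => //=; rewrite ax anc_id //; nlia.
have [||pp lp] := IH l0.+1; [by []|by nlia|].
rewrite /= rev_cons rcons_path last_rcons; split => //.
rewrite pp /= /berge_step lp /=.
have [] := @bfs_par bfs (anc l0 x); first by rewrite lev_anc //; nlia.
move=> -> -> + _ /=.
by rewrite [anc l0.-1 x]anc_par; [rewrite prednK|nlia].
Qed.

(** The start may be any vertex of the first tree hyperedge, not only the parent; this covers two
    branches hanging from one hyperedge. *)
Lemma down_pathP y t l0 a : lev y <= k -> 0 < l0 -> l0 + t = lev y ->
  a.1 \in te (anc l0 y) ->
  path (berge_step E) a (map (down_entry y) (iota l0 t.+1)) /\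
  (last a (map (down_entry y) (iota l0 t.+1))).1 = y.
Proof.
move=> yk; elim: t l0 a => [|t IH] l0 a l00 ht ha.
  rewrite addn0 in ht; rewrite /= /berge_step /= ht.
  have [] := @bfs_par bfs (anc l0 y); first by rewrite lev_anc //; nlia.
  by move=> teE wte _ _; rewrite -ht teE ha wte /= ht anc_id.
have [teE wte pte _] : [/\ te (anc l0 y) \in E, anc l0 y \in te (anc l0 y),
    par (anc l0 y) \in te (anc l0 y) & (lev (par (anc l0 y))).+1 = lev (anc l0 y)].
  by apply: (bfs_par bfs); rewrite lev_anc //; nlia.
have [_ _ pt2 _] : [/\ te (anc l0.+1 y) \in E, anc l0.+1 y \in te (anc l0.+1 y),
    par (anc l0.+1 y) \in te (anc l0.+1 y) & (lev (par (anc l0.+1 y))).+1 = lev (anc l0.+1 y)].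
  by apply: (bfs_par bfs); rewrite lev_anc //; nlia.
have [|||pp lp] := IH l0.+1 (down_entry y l0); [by []|by nlia| |].
  by rewrite /= anc_par //; nlia.
split; last exact: lp.
change (berge_step E a (down_entry y l0) &&
  path (berge_step E) (down_entry y l0) (map (down_entry y) (iota l0.+1 t.+1))).
by rewrite pp andbT /berge_step /= teE ha wte.
Qed.

Definition tree_edges := [set te w | w in [set w | 0 < lev w <= k]].

(* At the branching level [s] the two tree paths join through two hyperedges, or
   through a single one when both branches hang from the same hyperedge. *)
Definition tree_dist s x y :=
  (lev x - s) + (lev y - s) - (te (anc s.+1 x) == te (anc s.+1 y)).

(** The walk [P] is closed by climbing from [x] to the branching level and descending to [y]. [P]
    stays on the level of [x], the climb enters only lower levels, and the descent meets that level
    at most in [anc (lev x) y], so excluding this vertex keeps [P] disjoint from the tree part. *)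
Lemma close_cycle m s y x (P : seq ('I_n * {set 'I_n})) :
  lev x <= k -> lev y <= k -> s < lev x -> s < lev y ->
  anc s x = anc s y -> anc s.+1 x != anc s.+1 y ->
  path (berge_step E) (y, set0) P -> (last (y, set0) P).1 = x ->
  uniq (unzip1 P) -> uniq (unzip2 P) ->
  (forall e, e \in unzip2 P -> e \notin tree_edges) ->
  (forall w, w \in unzip1 P -> lev w = lev x) ->
  anc (lev x) y \notin unzip1 P ->
  size P + tree_dist s x y = m -> has_berge_cycle m E.
Proof.
move=> xk yk sx sy eqs nes pP lP u1 u2 nt levP ncP <-.
rewrite /tree_dist; move shE: (te (anc s.+1 x) == te (anc s.+1 y)) => sh.
(* If the branches share a hyperedge, the climb stops at level [s + 1] and that hyperedge is crossed
   once, by the descent. *)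
pose U := rev (map (up_entry x) (iota (s.+1 + sh) (lev x - s - sh))).
pose D := map (down_entry y) (iota s.+1 (lev y - s.+1).+1).
have [|||pU lU] := @up_pathP x (lev x - s - sh) (s.+1 + sh) (last (y, set0) P) xk.
- by [].
- by case: (sh); nlia.
- exact: lP.
have ne_anc l : s < l -> l <= lev x -> l <= lev y -> anc l x != anc l y.
  move=> sl lx ly; apply: contraNneq nes => h.
  by rewrite (anc_eq_down sl lx ly h).
have levx l : l <= lev x -> lev (anc l x) = l by exact: lev_anc.
have levy l : l <= lev y -> lev (anc l y) = l by exact: lev_anc.
have [|||pD lD] := @down_pathP y (lev y - s.+1) s.+1 (last (last (y, set0) P) U) yk.
- by [].
- by nlia.
- rewrite lU; move: shE; case: (sh) => [/eqP h|_].
    rewrite addn1 /= -h.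
    by have [] := @bfs_par bfs (anc s.+1 x); first by rewrite levx; nlia.
  rewrite addn0 /= eqs anc_par //.
  by have [] := @bfs_par bfs (anc s.+1 y); first by rewrite levy; nlia.
have inU l : (l \in iota (s.+1 + sh) (lev x - s - sh)) = (s.+1 + sh <= l <= lev x).
  by rewrite mem_iota; case: (sh); nlia.
have inD l : (l \in iota s.+1 (lev y - s.+1).+1) = (s < l <= lev y).
  by rewrite mem_iota; nlia.
have tr l z : lev z <= k -> 0 < l <= lev z -> te (anc l z) \in tree_edges.
  by move=> zk hl; apply: imset_f; rewrite inE lev_anc //; nlia.
apply: (@has_berge_cycle_seq _ _ (P ++ U ++ D)).
- by case: (sh); nlia.
- rewrite !size_cat size_rev !size_map !size_iota.
  by case: (sh); nlia.
- rewrite (cycle_path (y, set0)) (@berge_path_start _ _ _ (y, set0)); last first.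
    by rewrite !last_cat.
  by rewrite !cat_path pP pU pD.
- rewrite /unzip1 !map_cat map_rev -!map_comp !cat_uniq u1 rev_uniq has_cat has_rev.
  rewrite !map_inj_in_uniq ?iota_uniq ?andbT ?andTb; last 2 first.
  + by move=> l l'; rewrite !inD /= => h h' /(congr1 lev); rewrite !levy; nlia.
  + by move=> l l'; rewrite !inU /= => h h' /(congr1 lev); rewrite !levx; nlia.
  apply/andP; split.
       rewrite negb_or; apply/andP; split; apply/hasPn => w /mapP[l] /= + ->.
      rewrite inU => h; apply/negP => /levP; rewrite levx; nlia.
    rewrite inD => h; apply: contra ncP => hP.
    by have := levP _ hP; rewrite levy; [move=> <- //|nlia].
  apply/hasPn => w /mapP[l] /= + ->; rewrite inD mem_rev => h.
  apply/negP => /mapP[l']; rewrite inU /= => h' e.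
  have el := congr1 lev e; rewrite levx ?levy in el; try by nlia.
  by have := @ne_anc l; rewrite e -el eqxx; nlia.
rewrite /unzip2 !map_cat map_rev -!map_comp !cat_uniq u2 rev_uniq has_cat has_rev.
have te_inj l l' z z' : lev z <= k -> lev z' <= k -> 0 < l <= lev z -> 0 < l' <= lev z' ->
    te (anc l z) = te (anc l' z') -> l = l' /\ anc l.-1 z = anc l'.-1 z'.
  move=> zk zk' h h' /te_eq []; rewrite ?lev_anc //; try by nlia.
  move=> el e; split=> //.
  by rewrite anc_par 1?[RHS]anc_par ?prednK ?e //; nlia.
rewrite !map_inj_in_uniq ?iota_uniq ?andbT ?andTb; last 2 first.
+ by move=> l l'; rewrite !inD /= => h h' e;
     case: (te_inj l l' y y yk yk _ _ e) => //; nlia.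
+ by move=> l l'; rewrite !inU /= => h h' e;
     case: (te_inj l l' x x xk xk _ _ e) => //; nlia.
apply/andP; split.
  rewrite negb_or; apply/andP; split; apply/hasPn => w /mapP[l] /= + ->.
    by rewrite inU => h; apply/negP => /nt; rewrite tr //; nlia.
  by rewrite inD => h; apply/negP => /nt; rewrite tr //; nlia.
apply/hasPn => w /mapP[l] /= + ->; rewrite inD mem_rev => h.
apply/negP => /mapP[l']; rewrite inU /= => h' e.
have [||el ea] := te_inj _ _ _ _ yk xk _ _ e; [nlia|nlia|].
move: e ea; rewrite -el => e ea.
(* A hyperedge common to climb and descent makes the ancestors agree at level [l - 1], so
   [l = s + 1]; but then the hyperedge is shared and the climb has omitted it. *)
have ls : l = s.+1.
  apply/eqP; rewrite eqn_leq; apply/andP; split; last by nlia.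
  rewrite leqNgt; apply/negP => hl.
  by have := @ne_anc l.-1; rewrite ea eqxx; nlia.
by move: shE h'; rewrite -ls e eqxx => <-; nlia.
Qed.

(** * Graphs traced by hyperedges on a vertex set, and their Berge walks *)

Section Traces.
Variables (G : {set {set 'I_n}}) (U : {set 'I_n}).

(* A graph [r] on [U] whose edges are represented by distinct hyperedges of [G]. *)
Record edge_rep (r : rel 'I_n) (h : 'I_n -> 'I_n -> {set 'I_n}) : Prop := EdgeRep {
  rep_sym : symmetric r;
  rep_irr : irreflexive r;
  rep_U : forall x y, r x y -> y \in U;
  rep_symh : forall x y, h x y = h y x;
  rep_G : forall x y, r x y -> [/\ h x y \in G, x \in h x y & y \in h x y];
  rep_inj : forall x y x' y', r x y -> r x' y' -> h x y = h x' y' ->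
    [set x; y] = [set x'; y'] }.

(** Each hyperedge of [G] is replaced by one pair [phi e] of its vertices in [U]. Linearity makes
    these pairs distinct, so the density passes to a graph and [min_degree_subset] applies. *)
Lemma dense_traces d : 0 < d -> G \subset E ->
  (forall e, e \in G -> 1 < #|e :&: U|) -> d * #|U| < #|G| ->
  exists r h (S : {set 'I_n}), [/\ edge_rep r h, S != set0,
    forall x y, r x y -> y \in S & forall x, x \in S -> d < #|[set y | r x y]|].
Proof.
move=> d0 /subsetP GE G2 hd.
pose phi (e : {set 'I_n}) : {set 'I_n} :=
  odflt set0 [pick A : {set 'I_n} | (A \subset e :&: U) && (#|A| == 2)].
have phiP e : e \in G -> phi e \subset e :&: U /\ #|phi e| = 2.
  move=> eG; rewrite /phi; case: pickP => [A /andP[? /eqP] //|no].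
  have /card_gt1P[x [y [xe ye xy]]] := G2 e eG.
  have := no [set x; y]; rewrite cards2 xy eqxx andbT.
  by move/negP; case; apply/subsetP => z /set2P[] ->.
have phi_inj e e' x y : e \in G -> e' \in G -> x != y ->
    phi e = [set x; y] -> phi e' = [set x; y] -> e = e'.
  move=> eG eG' xy pe pe'.
  have [/subsetP] := phiP e eG; rewrite pe => s1 _.
  have [/subsetP] := phiP e' eG'; rewrite pe' => s2 _.
  have [/setIP[x1 _] /setIP[y1 _]] := (s1 x (set21 _ _), s1 y (set22 _ _)).
  have [/setIP[x2 _] /setIP[y2 _]] := (s2 x (set21 _ _), s2 y (set22 _ _)).
  exact: (E_lin (GE _ eG) (GE _ eG') xy).
have U0 : U != set0.
  apply: contraTneq hd => U0; rewrite U0 cards0 muln0 -leqNgt leqn0 cards_eq0.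
  by apply/eqP/setP => e; rewrite inE; apply/negP => /G2; rewrite U0 setI0 cards0.
have [|||S [SU S0] degS] := @min_degree_subset _ _ phi G U d 1 d0 U0.
- by move=> e /phiP[h _]; apply: subset_trans h (subsetIr _ _).
- by move=> e /phiP[_ ->].
- by rewrite mul1n ltnW.
pose hs (A : {set 'I_n}) : {set 'I_n} :=
  odflt set0 [pick e | [&& e \in G, phi e \subset S & phi e == A]].
pose r := [rel x y | (x != y) &&
  [exists e, [&& e \in G, phi e \subset S & phi e == [set x; y]]]].
have rP x y : r x y -> [/\ x != y, hs [set x; y] \in G,
    phi (hs [set x; y]) = [set x; y] & [set x; y] \subset S].
  case/andP => xy /existsP[e0 he0]; rewrite /hs; case: pickP => [e|/(_ e0)] /=.
    by case/and3P => eG eS /eqP pe; rewrite -pe.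
  by rewrite he0.
exists r, (fun x y => hs [set x; y]), S; split=> //.
- split.
  + by move=> x y; rewrite /r /= eq_sym setUC.
  + by move=> x; rewrite /r /= eqxx.
  + move=> x y /rP[_ _ _ /subsetP h]; apply: (subsetP SU); apply: h.
    exact: set22.
  + by move=> x y; rewrite setUC.
  + move=> x y /rP[_ hG ph _]; have [/subsetP] := phiP _ hG; rewrite ph => sub _.
    split=> //.
      by have /setIP[] := sub x (set21 _ _).
    by have /setIP[] := sub y (set22 _ _).
  + by move=> x y x' y' /rP[_ _ p1 _] /rP[_ _ p2 _] e; rewrite -p1 -p2 e.
- by move=> x y /rP[_ _ _ /subsetP h]; apply: h; apply: set22.
(* The degree bound counts hyperedges; each of them is [hs [set x; y]] for some neighbour [y] of
   [x], so there are at least as many neighbours. *)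
move=> x xS; have := degS x xS; rewrite mul1n => /leq_trans; apply.
apply: leq_trans (leq_imset_card (fun y => hs [set x; y]) _).
apply: subset_leq_card; apply/subsetP => e; rewrite inE => /and3P[eG eS xe].
have [sub /eqP/cards2P[a [b [ab pe]]]] := phiP e eG.
have [y pe' xy] : exists2 y, phi e = [set x; y] & x != y.
  move: xe; rewrite pe !inE => /orP[] /eqP ->; first by exists b.
  by exists a; rewrite 1?setUC // eq_sym.
have rxy : r x y.
  by rewrite /r /= xy; apply/existsP; exists e; rewrite eG eS pe' eqxx.
apply/imsetP; exists y; first by rewrite inE.
have [_ hG ph _] := rP _ _ rxy.
exact: (phi_inj _ _ x y).
Qed.

Variables (r : rel 'I_n) (h : 'I_n -> 'I_n -> {set 'I_n}).
Hypothesis rh : edge_rep r h.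
Hypothesis GE : G \subset E.

Definition berge_walk x p := pairmap (fun a b => (b, h a b)) x p.

Lemma berge_walk1 x p : unzip1 (berge_walk x p) = p.
Proof. by elim: p x => //= y p IH x; rewrite IH. Qed.

Lemma size_berge_walk x p : size (berge_walk x p) = size p.
Proof. exact: size_pairmap. Qed.

Lemma last_berge_walk x p f : (last (x, f) (berge_walk x p)).1 = last x p.
Proof. by elim: p x f => //= y p IH x f; rewrite IH. Qed.

Lemma path_berge_walk x p f : path r x p ->
  path (berge_step E) (x, f) (berge_walk x p).
Proof.
elim: p x f => //= y p IH x f /andP[xy /IH ->]; rewrite andbT /berge_step /=.
by have [/(subsetP GE) -> -> ->] := rep_G rh xy.
Qed.

Lemma berge_walk2 x p e : path r x p -> e \in unzip2 (berge_walk x p) ->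
  exists a b, [/\ r a b, a \in x :: p, b \in x :: p & e = h a b].
Proof.
elim: p x => //= y p IH x /andP[xy yp]; rewrite inE => /orP[/eqP ->|].
  by exists x, y; rewrite !inE !eqxx orbT.
move/(IH _ yp) => [a [b [ab ap bp ->]]]; exists a, b.
by split=> //; rewrite inE ?ap ?bp orbT.
Qed.

(** By [rep_inj] a repeated hyperedge would represent the same pair, and a vertex of the path would
    recur. *)
Lemma uniq_berge_walk2 x p : path r x p -> uniq (x :: p) ->
  uniq (unzip2 (berge_walk x p)).
Proof.
elim: p x => // y p IH x /andP[xy yp] /andP[xp up] /=.
rewrite IH // andbT; apply/negP => /(berge_walk2 yp) [a [b [ab ap bp he]]].
have : x \in [set a; b] by rewrite -(rep_inj rh xy ab he) set21.
by move/set2P => [] xx; move: xp; rewrite xx ?ap ?bp.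
Qed.

Lemma berge_walk_nontree x p : (forall e, e \in G -> e \notin tree_edges) ->
  path r x p -> forall e, e \in unzip2 (berge_walk x p) -> e \notin tree_edges.
Proof.
move=> nt xp e /(berge_walk2 xp) [a [b [ab _ _ ->]]]; apply: nt.
by have [] := rep_G rh ab.
Qed.

End Traces.

(** * A dense trace on one level forces a cycle of length 2k+1 *)

Lemma dense_level_berge_cycle i (U : {set 'I_n}) (G : {set {set 'I_n}}) :
  0 < i <= k -> (forall u, u \in U -> lev u = i) -> G \subset E ->
  (forall e, e \in G -> e \notin tree_edges) ->
  (forall e, e \in G -> 1 < #|e :&: U|) ->
  (forall e z, e \in G -> z \in e -> lev z <= k) ->
  (2 * k).-1 * #|U| < #|G| -> has_berge_cycle (2 * k + 1) E.
Proof.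
move=> ik levU GE nt G2 levG hd.
apply: contraT => noC.
have [|r [h [S [rh S0 rS degS]]]] := dense_traces _ GE G2 hd; first by nlia.
have {degS} degS x : x \in S -> 2 * k <= #|[set y | r x y]|.
  by move/degS; clear; nlia.
have r_sym := rep_sym rh; have r_irr := rep_irr rh.
have lr x y : r x y -> lev y = i by move/(rep_U rh)/levU.
have lr' x y : r x y -> lev x = i by rewrite r_sym => /lr.
have lev_path x p w : lev x = i -> path r x p -> w \in p -> lev w = i.
  elim: p x => //= y p IH x lx /andP[/lr ly yp].
  by rewrite inE => /orP[/eqP -> //|]; apply: IH yp.
have lev_last x p : lev x = i -> path r x p -> lev (last x p) = i.
  move=> lx xp; have := mem_last x p; rewrite inE => /orP[/eqP -> //|].
  exact: lev_path xp.
have ne_r x y : r x y -> x != y by apply: contraTneq => ->; rewrite r_irr.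
have ik' : i <= k by nlia.
(* Level [s + 1] is the first one separating the ends of some edge. Level [i] does separate them, as
   [anc i] is the identity there; level 0 does not, as it is the root. *)
have [s [si eq_s [u [v [uv ne_s]]]]] : exists s, [/\ s < i,
    forall x y, r x y -> anc s x = anc s y &
    exists u v, r u v /\ anc s.+1 u != anc s.+1 v].
  pose P s := [exists u, exists v, r u v && (anc s.+1 u != anc s.+1 v)].
  have [x xS] := set0Pn _ S0.
  have [y xy] : exists y, r x y.
    have /card_gt0P[y] : 0 < #|[set y | r x y]|.
      by apply: leq_trans (degS x xS); nlia.
    by rewrite inE => ?; exists y.
  have Pi : P i.-1.
    apply/existsP; exists x; apply/existsP; exists y.
    by rewrite xy prednK ?anc_id ?(lr' _ _ xy) ?(lr _ _ xy) ?ne_r //; nlia.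
  have exP : exists s, P s by exists i.-1.
  case: (ex_minnP exP) => s /existsP[a /existsP[b /andP[ab neab]]] mins.
  exists s; split; first by have := mins _ Pi; nlia.
    move=> x1 y1 xy1; case: (s) mins => [|s'] mins.
      by apply: anc_root; rewrite ?(lr _ _ xy1) ?(lr' _ _ xy1).
    apply/eqP; apply: contraT => ne.
    suff /mins : P s' by rewrite ltnn.
    by apply/existsP; exists x1; apply/existsP; exists y1; rewrite xy1 ne.
  by exists a, b.
have eq_s_path x p : path r x p -> anc s (last x p) = anc s x.
  by elim: p x => //= y p IH x /andP[/eq_s -> /IH].
have cyc x p : lev x = i -> path r x p -> uniq (x :: p) ->
    anc s.+1 (last x p) != anc s.+1 x ->
    size p + tree_dist s (last x p) x != 2 * k + 1.
  move=> lx xp up ne; apply: contraNneq noC => sz.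
  have ll := lev_last _ _ lx xp.
  apply: (@close_cycle _ s x (last x p) (berge_walk h x p)) ne _ _ _ _ _ _ _ _ => //.
  - by rewrite ll.
  - by rewrite lx.
  - by rewrite ll.
  - by rewrite lx.
  - exact: eq_s_path.
  - exact: path_berge_walk rh GE _ _ _ xp.
  - exact: last_berge_walk.
  - by rewrite berge_walk1; case/andP: up.
  - exact: uniq_berge_walk2 rh _ _ xp up.
  - exact: berge_walk_nontree rh _ _ nt xp.
  - by move=> w; rewrite berge_walk1 ll; apply: lev_path xp.
  - by rewrite berge_walk1 ll anc_id ?lx //; case/andP: up.
  - by rewrite size_berge_walk.
have lev0 x p : path r x p -> 0 < size p -> lev x = i.
  by case: p => //= y p /andP[/lr' ->].
(* Distinct tree hyperedges at the branching give tree distance 2(i-s), which an odd path of length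
   2(k-i+s)+1 completes to 2k+1. *)
have eq_te x y : r x y -> te (anc s.+1 x) = te (anc s.+1 y).
  apply: (@monochromatic_edges _ r S (2 * k) r_sym r_irr rS degS _
    (fun x => te (anc s.+1 x)) (2 * (k - i + s) + 1)) => //.
  - by rewrite addn1 /= mul2n odd_double.
  - by nlia.
  move=> x1 p xp up sp; apply/eqP; apply: contraT => ne.
  have lx := lev0 _ _ xp; rewrite sp addn1 in lx; have {}lx := lx isT.
  have ne' : anc s.+1 (last x1 p) != anc s.+1 x1.
    by apply: contraNneq ne => ->.
  case/negP: (cyc _ _ lx xp up ne').
  rewrite /tree_dist (negPf ne) sp lx (lev_last _ _ lx xp) eq_sym; apply/eqP.
  by nlia.
have eq_te_path x p : path r x p -> te (anc s.+1 (last x p)) = te (anc s.+1 x).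
  by elim: p x => //= y p IH x /andP[/eq_te -> /IH].
have nontree x y w : r x y -> 0 < lev w <= k -> x \in te w -> y \in te w -> False.
  move=> xy wk xw yw; have [hG xh yh] := rep_G rh xy.
  have := nt _ hG.
  have [tE _ _ _] := bfs_par bfs wk.
  rewrite (E_lin (subsetP GE _ hG) tE (ne_r _ _ xy) xh yh xw yw).
  by rewrite imset_f // inE.
(* Otherwise [u] and [v] themselves would lie in one tree hyperedge, which linearity forbids. *)
have ssi : s.+1 < i.
  rewrite ltn_neqAle si andbT; apply/negP => /eqP si'.
  have lu := lr' _ _ uv; have lv := lr _ _ uv.
  have := eq_te _ _ uv; rewrite si' !anc_id ?lu ?lv // => ete.
  have [_ uu _ _] := @bfs_par bfs u ltac:(rewrite lu; nlia).
  have [_ vv _ _] := @bfs_par bfs v ltac:(rewrite lv; nlia).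
  by apply: (nontree u v u) => //; rewrite ?lu ?ete //; nlia.
(* Tree hyperedges now always coincide, so the tree distance is 2(i-s)-1 and the missing length is
   even; it is below 2k because [s.+1 < i]. *)
have nbrs : forall w x y, r w x -> r w y -> anc s.+1 x = anc s.+1 y.
  apply: (@monochromatic_nbrs _ r S (2 * k) r_sym r_irr rS degS _ _
     (2 * (k - i + s + 1))).
  - by nlia.
  - by nlia.
  move=> x1 p xp up sp; apply/eqP; apply: contraT => ne.
  have lx : lev x1 = i by apply: lev0 xp _; rewrite sp; nlia.
  case/negP: (cyc _ _ lx xp up ne).
  rewrite /tree_dist eq_te_path // eqxx sp lx (lev_last _ _ lx xp); apply/eqP.
  by nlia.
have alt x y p : r x y -> path r x p ->
    anc s.+1 (last x p) = anc s.+1 (if odd (size p) then y else x).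
  move=> xy xp; case: ifP => op.
    case: p xp op => //= w p /andP[xw wp] op.
    by rewrite (monochromatic_even_path r_sym nbrs wp op) (nbrs x w y).
  by rewrite (monochromatic_even_path r_sym nbrs xp (negbT op)).
have [hG uh vh] := rep_G rh uv.
have [z zh zuv] : exists2 z, z \in h u v & z \notin [set u; v].
  have /subsetPn[z] : ~~ (h u v \subset [set u; v]).
    apply/negP => /subset_leq_card; rewrite E3 ?(subsetP GE) //.
    by rewrite cards2 ne_r.
  by exists z.
have lu := lr' _ _ uv; have lv := lr _ _ uv.
have zi : i <= (lev z).+1.
  by have := bfs_lev bfs (subsetP GE _ hG) zh uh; rewrite lu.
have iz : lev z <= i.+1.
  by have := bfs_lev bfs (subsetP GE _ hG) uh zh; rewrite lu.
have zk : lev z <= k by apply: levG zh.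
(* [anc i z] is the only vertex at which the descent to [z] can meet level [i]. Were it the parent
   of [z] and equal to [u] or [v], then [te z] would share two vertices with [h u v]. *)
have Zuv : anc i z \notin [set u; v].
  have [lz|lz] := leqP (lev z) i; first by rewrite anc_id.
  have lz' : lev z = i.+1 by nlia.
  have zk' : 0 < lev z <= k by nlia.
  have [_ zz pz _] := bfs_par bfs zk'.
  rewrite anc_par // anc_id ?lz' //; apply/negP => puv.
  have [tE _ _ _] := bfs_par bfs zk'.
  have parh : par z \in h u v by case/set2P: puv => ->.
  have zpz : z != par z by apply: contraTneq puv => <-.
  have := nt _ hG.
  rewrite (E_lin (subsetP GE _ hG) tE zpz zh parh zz pz).
  by rewrite imset_f // inE.
(* The walk goes from [z] straight to [x] through [h u v], skipping [y], and then follows [p].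
   Avoiding [y] prevents a second use of [h u v]. *)
have fin x y p s' : r y x -> h y x = h u v -> [set x; y] = [set u; v] ->
    path r x p -> uniq (x :: p) -> all [predC [set y; anc i z]] p ->
    s' <= s -> anc s' (last x p) = anc s' z ->
    anc s'.+1 (last x p) != anc s'.+1 z ->
    size p + tree_dist s' (last x p) z = 2 * k -> False.
  move=> yx hyx exy xp up ap ss eqz nez sz; apply: (negP noC).
  have lx := lr _ _ yx; have ll := lev_last _ _ lx xp.
  have ypath : path r y (x :: p) by rewrite /= yx.
  have yup : uniq (y :: x :: p).
    rewrite cons_uniq up andbT inE negb_or ne_r //=.
    by apply/negP => /(allP ap); rewrite /= !inE eqxx.
  have ZP : anc i z \notin x :: p.
    rewrite inE negb_or; apply/andP; split.
      by apply: contraNneq Zuv => ->; rewrite -exy set21.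
    by apply/negP => /(allP ap); rewrite /= !inE eqxx orbT.
  apply: (@close_cycle _ s' z (last x p) (berge_walk h y (x :: p))) nez _ _ _ _ _ _ _ _ => //.
  - by rewrite ll.
  - by rewrite ll; nlia.
  - by nlia.
  - have := path_berge_walk rh GE (y, set0).2 ypath.
    rewrite /= => /andP[+ ->]; rewrite andbT /berge_step /= => /and3P[-> _ ->].
    by rewrite hyx zh.
  - exact: (last_berge_walk h x p).
  - by rewrite berge_walk1.
  - exact: uniq_berge_walk2 rh _ _ ypath yup.
  - exact: berge_walk_nontree rh _ _ nt ypath.
  - move=> w; rewrite berge_walk1 ll; exact: (lev_path y _ _ (lr' _ _ yx) ypath).
  - by rewrite berge_walk1 ll.
  - by rewrite size_berge_walk /= -sz; nlia.
have path_avoid x y l : r y x -> [set x; y] = [set u; v] -> l + 2 <= 2 * k ->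
    exists p, [/\ size p = l, path r x p, uniq (x :: p) &
                  all [predC [set y; anc i z]] p].
  move=> yx exy hl.
  apply: (greedy_path r_irr rS degS); first exact: rS yx.
    rewrite !inE negb_or eq_sym ne_r //.
    by apply: contraNneq Zuv => <-; rewrite -exy set21.
  by apply: leq_trans hl; rewrite leq_add2l cards2; case: (_ != _).
have hvu : h v u = h u v by rewrite (rep_symh rh).
have vu : r v u by rewrite r_sym.
(* Here [z] lies on the branch of [x]. The length [l] is forced, so its parity decides whether to
   start at [x] or at [y] for the path to end on the branch of [y]. *)
have finA x y : r y x -> h y x = h u v -> [set x; y] = [set u; v] ->
    anc s.+1 x != anc s.+1 y -> anc s.+1 z = anc s.+1 x -> False.
  move=> yx hyx exy ne ez.
  have xy : r x y by rewrite r_sym.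
  have lx := lr _ _ yx; have ly := lr' _ _ yx.
  pose l := 2 * k - ((i - s) + (lev z - s) - 1).
  have hl : l + 2 <= 2 * k by rewrite /l; nlia.
  have ez0 : anc s z = anc s x.
    by apply: (@anc_eq_down s s.+1); rewrite ?lx //; nlia.
  have [op|op] := boolP (odd l).
    have [p [sp xp up ap]] := path_avoid x y l yx exy hl.
    have := alt x y p xy xp; rewrite sp op => elast.
    apply: (fin x y p s) => //.
    - by rewrite eq_s_path.
    - by rewrite elast ez eq_sym.
    by rewrite /tree_dist eq_te_path // ez eqxx sp (lev_last _ _ lx xp) /l; nlia.
  have exy' : [set y; x] = [set u; v] by rewrite setUC.
  have [p [sp yp up ap]] := path_avoid y x l xy exy' hl.
  have := alt y x p yx yp; rewrite sp (negPf op) => elast.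
  apply: (fin y x p s) => //.
  - by rewrite (rep_symh rh).
  - by rewrite eq_s_path // ez0 (eq_s _ _ xy).
  - by rewrite elast ez eq_sym.
  rewrite /tree_dist eq_te_path // ez (eq_te _ _ yx) eqxx sp.
  by rewrite (lev_last _ _ ly yp) /l; nlia.
have [ezu|nzu] := eqVneq (anc s.+1 z) (anc s.+1 u).
  by case: (finA u v) => //; rewrite setUC.
have [ezv|nzv] := eqVneq (anc s.+1 z) (anc s.+1 v).
  by case: (finA v u) => //; rewrite 1?setUC // eq_sym.
(* Now [z] is on neither branch at level [s + 1]; it separates from [u] after some level [s' <= s].
   If [s' < s], every vertex of the path follows [u] at level [s' + 1]. *)
have [s' [ss' ez' nez']] : exists s', [/\ s' <= s, anc s' z = anc s' u &
    anc s'.+1 z != anc s'.+1 u].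
  have exP : exists t, anc t.+1 z != anc t.+1 u by exists s.
  case: (ex_minnP exP) => t nt' mint; exists t; split=> //; first exact: mint.
  case: (t) mint => [|t'] mint; first by apply: anc_root; rewrite ?lu.
  by apply/eqP; apply: contraT => /mint; rewrite ltnn.
have down x : lev x = i -> anc s x = anc s u -> s' < s -> anc s'.+1 x = anc s'.+1 u.
  by move=> lx ex hs; apply: anc_eq_down ex => //; rewrite ?lx ?lu; nlia.
have hl : 2 * k - tree_dist s' u z + 2 <= 2 * k.
  rewrite /tree_dist lu; case: (_ == _); nlia.
have [p [sp up uup ap]] := path_avoid u v _ vu erefl hl.
have ll := lev_last _ _ lu up.
case: (fin u v p s') => //.
- by rewrite ez'; apply: (@anc_eq_down s' s) => //; rewrite ?ll ?lu ?eq_s_path //; nlia.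
- move: ss'; rewrite leq_eqVlt => /orP[/eqP ->|ss'].
    by rewrite (alt u v p uv up); case: ifP => _; rewrite eq_sym.
  by rewrite down ?eq_s_path // eq_sym.
have ete : te (anc s'.+1 (last u p)) = te (anc s'.+1 u).
  move: ss'; rewrite leq_eqVlt => /orP[/eqP ->|ss']; first exact: eq_te_path.
  by rewrite down ?eq_s_path.
rewrite sp /tree_dist ll lu ete.
by case: (_ == _); nlia.
Qed.

(** * Counting degrees over one level *)

Section DegreeSum.
Hypothesis k0 : 0 < k.
Hypothesis acyclic : ~~ has_berge_cycle (2 * k + 1) E.

Definition level j := [set w | lev w == j].
Local Notation trace j e := #|e :&: level j|.

Hypothesis te_pref : forall w e, 0 < lev w <= k -> e \in E -> w \in e ->
  trace (lev w).-1 e = 1 -> trace (lev w).-1 (te w) = 1.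

Let c := (2 * k).-1.
Let inner j := [set e in E | (e \notin tree_edges) && (1 < trace j e)].
Let outer j :=
  [set e in E | [&& e \notin tree_edges, trace j e == 2 & trace j.-1 e == 1]].
(** These are the vertices for which [te_pref] provides a tree hyperedge with a single vertex on the
    previous level; outer hyperedges meet level [j] only in them. *)
Let reach j :=
  [set w in level j | [exists e in E, (w \in e) && (trace j.-1 e == 1)]].

Lemma sub_set3 (e A : {set 'I_n}) x : e \in E -> x \in e -> x \notin A ->
  #|e :&: A| <= 2.
Proof.
move=> eE xe xA; have := E3 eE; rewrite (cardsD1 x e) xe => -[<-].
apply: subset_leq_card; apply/subsetP => y /setIP[ye yA].
by rewrite !inE ye andbT; apply: contraNneq xA => <-.
Qed.

(** For [j < k] the third vertex of an inner hyperedge still has level at most [k]. Level 0 is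
    handled apart: it holds at most the root. *)
Lemma card_inner j : j < k -> #|inner j| <= c * #|level j|.
Proof.
move=> jk; case: j jk => [|j] jk.
  suff -> : inner 0 = set0 by rewrite cards0.
  apply/setP => e; rewrite !inE; apply/negbTE; rewrite !negb_and -leqNgt.
  apply/orP; right; apply/orP; right.
  rewrite -(cards1 x0); apply: subset_leq_card; apply/subsetP => y.
  by rewrite !inE => /andP[_ /eqP/(bfs_root bfs) ->].
rewrite leqNgt; apply: contra acyclic.
apply: (@dense_level_berge_cycle j.+1 (level j.+1) (inner j.+1)) => //.
- by rewrite (ltnW jk).
- by move=> u; rewrite inE => /eqP.
- by apply/subsetP => e; rewrite inE => /and3P[].
- by move=> e; rewrite inE => /and3P[].
- by move=> e; rewrite inE => /and3P[].
move=> e z; rewrite inE => /and3P[eE _ /ltnW/card_gt0P[u]].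
rewrite !inE => /andP[ue /eqP lu] ze.
by apply: leq_trans (bfs_lev bfs eE ue ze) _; rewrite lu.
Qed.

(** Here [j = k] is allowed: an outer hyperedge has a vertex on level [j - 1], so none of its
    vertices is beyond level [j]. *)
Lemma card_outer j : 0 < j <= k -> #|outer j| <= c * #|reach j|.
Proof.
move=> jk; rewrite leqNgt; apply: contra acyclic.
apply: (@dense_level_berge_cycle j (reach j) (outer j)) => //.
- by move=> u; rewrite !inE => /andP[/eqP].
- by apply/subsetP => e; rewrite inE => /andP[].
- by move=> e; rewrite inE => /and4P[].
- move=> e; rewrite inE => /and4P[eE _ /eqP e2 e1].
  rewrite -[1.+1]/2 -e2.
  apply: subset_leq_card; apply/subsetP => w /setIP[we wj].
  rewrite inE we inE wj; apply/existsP; exists e.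
  by rewrite eE we.
move=> e z; rewrite inE => /and4P[eE _ _ /eqP e1] ze.
have /card_gt0P[u] : 0 < trace j.-1 e by rewrite e1.
rewrite !inE => /andP[ue /eqP lu].
by apply: leq_trans (bfs_lev bfs eE ue ze) _; rewrite lu; nlia.
Qed.

(** A tree hyperedge is charged to a vertex [w] with [e = te w]. If a non-tree one meets level [i]
    once, its other two vertices differ by at most one level and avoid level [i], so both are on
    level [i - 1] or both on level [i + 1]. *)
Lemma trace_le i e : e \in E ->
  trace i e <= 3 * (e \in inner i) + (e \in inner i.-1) + (e \in outer i.+1)
    + \sum_(w in level i) 2 * (e == te w)
    + \sum_(w in level i.+1) trace i (te w) * (e == te w).
Proof.
move=> eE; case: (boolP (e \in tree_edges)) => [/imsetP[w + ee]|nt].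
  rewrite inE => wk; have [tE ww pw lp] := bfs_par bfs wk.
  have [lw|nlw] := eqVneq (lev w) i.
    rewrite addnAC; apply: leq_trans (leq_addl _ _); rewrite (bigD1 w) ?inE ?lw //=.
    rewrite ee eqxx muln1; apply: leq_trans (leq_addr _ _).
    by apply: (@sub_set3 _ _ (par w)) => //; rewrite inE; nlia.
  have [lw'|nlw'] := eqVneq (lev w) i.+1.
    apply: leq_trans (leq_addl _ _); rewrite (bigD1 w) ?inE ?lw' //=.
    by rewrite ee eqxx muln1 leq_addr.
  suff -> : trace i e = 0 by [].
  apply/eqP; rewrite cards_eq0; apply/eqP/setP => z; rewrite !inE.
  apply/negP => /andP[ze /eqP lz]; rewrite ee in ze.
  by have := te_lev wk ze; move: nlw nlw'; rewrite lz; clear; lia.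
have e3 := E3 eE.
have [b2|] := ltnP 1 (trace i e).
  have -> : e \in inner i by rewrite inE eE nt.
  rewrite muln1 -!addnA; apply: leq_trans (leq_addr _ _).
  by rewrite -e3 subset_leq_card // subsetIl.
rewrite leq_eqVlt => /orP[/eqP b1|]; last by rewrite ltnS leqn0 => /eqP ->.
have [u ue lu] : exists2 u, u \in e & lev u = i.
  have /card_gt0P[u] : 0 < trace i e by rewrite b1.
  by rewrite !inE => /andP[ue /eqP lu]; exists u.
have eu : #|e :\ u| = 2 by move: e3; rewrite (cardsD1 u) ue => -[].
have [x [y [xe ye xy]]] : exists x y, [/\ x \in e :\ u, y \in e :\ u & x != y].
  by apply/card_gt1P; rewrite eu.
have lev_ne w : w \in e :\ u -> lev w != i.
  rewrite !inE => /andP[wu we]; apply/negP => lw.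
  have : 1 < trace i e.
    by apply/card_gt1P; exists u, w; rewrite !inE ue we lu lw eqxx eq_sym.
  by rewrite b1.
have [xe' ye'] : x \in e /\ y \in e.
  by move: xe ye; rewrite !inE => /andP[_ ->] /andP[_ ->].
have nx := lev_ne _ xe; have ny := lev_ne _ ye.
have two j : lev x = j -> lev y = j -> 1 < trace j e.
  by move=> lx ly; apply/card_gt1P; exists x, y; rewrite !inE lx ly xe' ye' eqxx.
have := bfs_lev bfs eE ue xe'; have := bfs_lev bfs eE xe' ue.
have := bfs_lev bfs eE ue ye'; have := bfs_lev bfs eE ye' ue.
have := bfs_lev bfs eE xe' ye'; have := bfs_lev bfs eE ye' xe'.
rewrite lu => h1 h2 h3 h4 h5 h6; rewrite b1.
have [lx|lx] := leqP (lev x) i.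
  have -> : e \in inner i.-1.
    by rewrite inE eE nt two //; move: nx ny; clear -lx h1 h2 h3 h4 h5 h6; lia.
  by rewrite addn1 -addnA; nlia.
have -> : e \in outer i.+1.
  rewrite inE eE nt /= b1 eqxx andbT eqn_leq two; last 2 first.
  - by move: nx ny; clear -lx h1 h2 h3 h4 h5 h6; lia.
  - by move: nx ny; clear -lx h1 h2 h3 h4 h5 h6; lia.
  rewrite andbT; apply: (@sub_set3 _ _ u) => //.
  by rewrite inE lu; clear; lia.
do 2 apply: leq_trans (leq_addr _ _).
exact: leq_addl.
Qed.

Lemma sum_degree (A : {set 'I_n}) :
  \sum_(v in A) #|[set e in E | v \in e]| = \sum_(e in E) #|e :&: A|.
Proof.
under eq_bigr => v _ do rewrite -sum1dep_card big_mkcondr /=.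
rewrite exchange_big /=; apply: eq_bigr => e _.
rewrite -big_mkcondr -sum1dep_card; apply: eq_bigl => v.
by rewrite andbC.
Qed.

Lemma level_degree_sum i : i < k ->
  \sum_(v in level i) #|[set e in E | v \in e]| <=
    c * #|level i.-1| + (3 * c + 2) * #|level i| + c.+1 * #|level i.+1|.
Proof.
move=> ik; rewrite sum_degree.
apply: leq_trans (@leq_sum _ (index_enum _) (fun e => e \in E) _ _
  (fun e eE => @trace_le i e eE)) _.
rewrite !big_split /=.
have mulr a (F : {set 'I_n} -> nat) :
    \sum_(e in E) a * F e = a * \sum_(e in E) F e by rewrite big_distrr.
rewrite big1_eq.
have cnt (B : {set {set 'I_n}}) : \sum_(e in E) (e \in B : nat) <= #|B|.
  rewrite -big_mkcondr -sum1_card /=.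
  rewrite [leqLHS](_ : _ = \sum_(e in E :&: B) 1); last by apply: eq_bigl => e; rewrite inE.
  by rewrite !sum1_card subset_leq_card // subsetIr.
have dirac (f : 'I_n -> nat) (A : {set 'I_n}) :
    \sum_(e in E) \sum_(w in A) f w * (e == te w) <= \sum_(w in A) f w.
  rewrite exchange_big /=; apply: leq_sum => w _; rewrite mulr.
  rewrite -[leqRHS]muln1 leq_mul2l; apply/orP; right.
  have := cnt [set te w]; rewrite cards1; apply: leq_trans.
  by apply: leq_sum => e _; rewrite inE.
have i1 : #|inner i| <= c * #|level i| by apply: card_inner.
have i2 : #|inner i.-1| <= c * #|level i.-1| by apply: card_inner; nlia.
have o1 : #|outer i.+1| <= c * #|reach i.+1| by apply: card_outer; nlia.
have t1 : \sum_(e in E) \sum_(w in level i) 2 * (e == te w) <= 2 * #|level i|.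
  by have := dirac (fun=> 2) (level i); rewrite sum_nat_const mulnC.
have rl : #|reach i.+1| <= #|level i.+1|.
  by apply: subset_leq_card; apply/subsetP => w; rewrite inE => /andP[].
(* A vertex in [reach] costs [c] for outer hyperedges and 1 for its tree hyperedge, any other at
   most 2; both are at most [c + 1]. *)
have t2 : \sum_(w in level i.+1) trace i (te w) + #|reach i.+1| <= 2 * #|level i.+1|.
  have -> : #|reach i.+1| = \sum_(w in level i.+1) (w \in reach i.+1).
    rewrite -big_mkcondr -sum1_card /=; apply: eq_bigl => w.
    by rewrite [in LHS]inE !inE andbA andbb.
  rewrite -big_split /= mulnC -sum_nat_const; apply: leq_sum => w.
  rewrite inE => /eqP lw.
  have wk : 0 < lev w <= k by rewrite lw.
  have [tE ww _ _] := bfs_par bfs wk.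
  have t2 : trace i (te w) <= 2.
    by apply: (@sub_set3 _ _ w) => //; rewrite inE lw; clear; lia.
  case: (boolP (w \in reach i.+1)) => [|_]; last by rewrite addn0.
  rewrite !inE => /andP[_ /exists_inP[e eE /andP[we /eqP e1]]].
  by have := te_pref wk eE we; rewrite lw /= => ->.
have d2 := dirac (fun w => trace i (te w)) (level i.+1).
have n1 := cnt (inner i); have n2 := cnt (inner i.-1).
have n3 := cnt (outer i.+1).
have {cnt dirac mulr} c0 : 0 < c by rewrite /c; nlia.
have cr : c.-1 * #|reach i.+1| <= c.-1 * #|level i.+1| by rewrite leq_mul2l rl orbT.
move: t1 t2 i1 i2 o1 rl c0 d2 n1 n2 n3 cr.
move: (\sum_(e in E) (e \in inner i)) (\sum_(e in E) (e \in inner i.-1)).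
move: (\sum_(e in E) (e \in outer i.+1)) (\sum_(e in E) \sum_(w in level i) _).
move: (\sum_(e in E) \sum_(w in level i.+1) _) (\sum_(w in level i.+1) _).
move: #|inner i| #|inner i.-1| #|outer i.+1| #|reach i.+1| c.
clear => ? ? ? ? [|c] //=; nia.
Qed.

End DegreeSum.

End Tree.

(** * Existence of the tree and the final estimate *)

Section Bfs.
Variables (n k : nat) (E : {set {set 'I_n}}) (x0 : 'I_n).

Fixpoint ball j : {set 'I_n} :=
  if j is j'.+1 then
    ball j' :|: [set w | [exists e in E, (w \in e) && (e :&: ball j' != set0)]]
  else [set x0].

(** For a vertex outside all balls of radius at most [k], [find] returns the list length [k + 1]:
    this is the cap. *)
Definition dist w := find (fun j => w \in ball j) (iota 0 k.+1).

Lemma subset_ball i j : i <= j -> ball i \subset ball j.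
Proof.
elim: j => [|j IH]; first by rewrite leqn0 => /eqP ->.
rewrite leq_eqVlt => /orP[/eqP -> //|/IH h].
exact: subset_trans h (subsetUl _ _).
Qed.

Lemma dist_max w : dist w <= k.+1.
Proof. by rewrite -[k.+1](size_iota 0) find_size. Qed.

Lemma dist_le w j : j <= k -> (dist w <= j) = (w \in ball j).
Proof.
move=> jk; apply/idP/idP => [wj|wj].
  have wk : dist w < size (iota 0 k.+1) by rewrite size_iota; nlia.
  have := wk; rewrite -has_find => /(nth_find 0); rewrite -/(dist w).
  rewrite size_iota in wk; rewrite nth_iota // add0n.
  exact: (subsetP (subset_ball wj)).
rewrite leqNgt; apply/negP => /(before_find 0).
by rewrite nth_iota ?add0n ?wj.
Qed.

Lemma dist_adj e u v : e \in E -> u \in e -> v \in e -> dist v <= (dist u).+1.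
Proof.
move=> eE ue ve; have [uk|uk] := ltnP (dist u) k; last first.
  exact: leq_trans (dist_max v) _.
rewrite dist_le //= !inE; apply/orP; right; apply/exists_inP; exists e => //.
rewrite ve; apply/set0Pn; exists u; rewrite inE ue -dist_le ?leqnn //.
exact: ltnW.
Qed.

Lemma dist_pred w : 0 < dist w <= k ->
  exists e u, [/\ e \in E, w \in e, u \in e & (dist u).+1 = dist w].
Proof.
case dw: (dist w) => [|j] // jk.
have : w \in ball j.+1 by rewrite -dist_le ?dw.
have /negPf wj : w \notin ball j by rewrite -dist_le ?dw ?ltnn // ltnW.
rewrite /= inE wj /= inE => /exists_inP[e eE /andP[we /set0Pn[u /setIP[ue ub]]]].
exists e, u; split=> //; have := dist_adj eE ue we.
by rewrite dw; move: ub; rewrite -dist_le; [nlia|exact: ltnW].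
Qed.

Lemma bfs_exists : exists lev par te,
  [/\ bfs_tree k E x0 lev par te, lev x0 = 0 &
    forall w e, 0 < lev w <= k -> e \in E -> w \in e ->
      #|e :&: level lev (lev w).-1| = 1 ->
      #|te w :&: level lev (lev w).-1| = 1].
Proof.
pose L w := level dist (dist w).-1.
(* A hyperedge meeting the previous level exactly once is preferred; any hyperedge meeting it is the
   fallback. *)
pose te w : {set 'I_n} :=
  if [pick e | [&& e \in E, w \in e & #|e :&: L w| == 1]] is Some e then e
  else odflt set0 [pick e | [&& e \in E, w \in e & e :&: L w != set0]].
pose par w := odflt w [pick u in te w :&: L w].
have LP w u : 0 < dist w -> (u \in L w) = ((dist u).+1 == dist w).
  by move=> w0; rewrite inE -{2}(prednK w0) eqSS.
have teP w : 0 < dist w <= k -> [/\ te w \in E, w \in te w & te w :&: L w != set0].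
  move=> wk; rewrite /te; case: pickP => [e /and3P[-> -> /eqP e1]|_].
    by split=> //; rewrite -card_gt0 e1.
  case: pickP => [e /and3P[-> -> ->] //|no].
  have [e [u [eE we ue uw]]] := dist_pred wk.
  have := no e; rewrite eE we /= => /negbT/negP[]; apply/set0Pn; exists u.
  by rewrite inE ue LP ?uw //; nlia.
exists dist, par, te; split.
- split.
  + exact: dist_adj.
  + move=> w w0; have : dist w <= 0 by rewrite w0.
    by rewrite dist_le //= inE => /eqP.
  move=> w wk; have [tE ww /set0Pn[u uP]] := teP w wk; split=> //.
    rewrite /par; case: pickP => [v /setIP[] //|/(_ u)].
    by rewrite uP.
  rewrite /par; case: pickP => [v /setIP[_]|/(_ u)]; last by rewrite uP.
  by rewrite LP => [/eqP //|]; nlia.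
- by apply/eqP; rewrite -leqn0 dist_le //= inE.
move=> w e wk eE we e1; rewrite /te.
case: pickP => [f /and3P[_ _ /eqP] //|/(_ e)].
by rewrite eE we e1 eqxx.
Qed.

End Bfs.

Lemma has_berge_cycle_sub n m (E F : {set {set 'I_n}}) :
  E \subset F -> has_berge_cycle m E -> has_berge_cycle m F.
Proof.
move=> /subsetP EF /existsP[H /existsP[v /and3P[iH iv /forallP hv]]].
apply/existsP; exists H; apply/existsP; exists v; rewrite iH iv.
by apply/forallP => i; have /and3P[/EF -> -> ->] := hv i.
Qed.

(** * Growth of the levels and the final bound *)

Open Scope R_scope.

(* The hypothesis forces consecutive terms to grow by a factor above [x]. *)
Lemma degree_sum_growth (k d : nat) (x : R) (a : nat -> nat) :
  (1 < k)%nat -> 1 <= x -> 2 * INR k * x + 9 * INR k <= INR d ->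
  (0 < a 0)%nat ->
  (forall i, (i < k)%nat -> (d * a i <= (2 * k).-1 * a i.-1
     + (3 * (2 * k).-1 + 2) * a i + (2 * k).-1.+1 * a i.+1)%nat) ->
  x ^ k < INR (a k).
Proof.
move=> k1 x1 hd a0 step.
have k1' : 2 <= INR k by apply: (le_INR 2); apply/leP.
(* Monotonicity absorbs [a i.-1] into [a i], with total coefficient 8k-2 rounded up to 8k. The spare
   k out of 9k makes the inequality strict. *)
have grow i : (i < k)%nat -> (a i.-1 <= a i)%nat -> (0 < a i)%nat ->
    x * INR (a i) < INR (a i.+1).
  move=> ik ai ai0.
  have : (d * a i <= 8 * k * a i + 2 * k * a i.+1)%nat.
    have := step i ik; have : ((2 * k).-1 * a i.-1 <= (2 * k).-1 * a i)%nat.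
      by rewrite leq_mul2l ai orbT.
    move: k1; clear; case: k => // m _; rewrite mulnS /=; nia.
  move=> /leP/le_INR; rewrite !plus_INR !mult_INR.
  have -> : INR 8 = 8 by rewrite /=; lra.
  have -> : INR 2 = 2 by rewrite /=; lra.
  have ap : 0 < INR (a i) by apply: (lt_INR 0); apply/ltP.
  set A := INR (a i); set B := INR (a i.+1); set K := INR k; set D := INR d => h.
  have hdA : (2 * K * x + 9 * K) * A <= D * A.
    by apply: Rmult_le_compat_r; [apply: Rlt_le|].
  have KA : 0 < K * A by apply: Rmult_lt_0_compat => //; rewrite /K; lra.
  have : 2 * K * (x * A) < 2 * K * B by lra.
  by move/Rmult_lt_reg_l; apply; rewrite /K; lra.
(* Strictness starts at [i = 1], since [x ^ 0] may equal [a 0]. *)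
have inv i : (i <= k)%nat ->
    [/\ x ^ i <= INR (a i), (a i.-1 <= a i)%nat & (0 < a i)%nat] /\
    ((0 < i)%nat -> x ^ i < INR (a i)).
  elim: i => [|i IH] ik.
    by split=> //; split=> //=; apply: (le_INR 1); apply/leP.
  have [[xa ai ai0] _] := IH (ltnW ik).
  have g := grow i ik ai ai0.
  have ap : 0 < INR (a i) by apply: (lt_INR 0); apply/ltP.
  have lt : x ^ i.+1 < INR (a i.+1).
    by apply: Rle_lt_trans g; rewrite /=; apply: Rmult_le_compat_l; lra.
  have le : INR (a i) < INR (a i.+1) by nra.
  move/INR_lt/ltP: le => le.
  by split=> //; split; [apply: Rlt_le|apply: ltnW|apply: leq_trans le].
by have [_] := inv k (leqnn k); apply; apply: ltnW.
Qed.

Theorem theorem3 (k n : nat) (hk : (2 <= k)%nat) (hn : (0 < n)%nat) :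
  INR (ex_lin3 n (2 * k + 1)) <=
  2 * INR k * Rpower (INR n) (1 + 1 / INR k) + 9 * INR k * INR n.
Proof.
have k2 : 2 <= INR k by apply: (le_INR 2); apply/leP.
have n1 : 1 <= INR n by apply: (le_INR 1); apply/leP.
set x := Rpower (INR n) (1 / INR k).
have x1 : 1 <= x.
  rewrite -(Rpower_O (INR n)); last by lra.
  apply: Rle_Rpower => //; apply: Rlt_le; apply: Rdiv_lt_0_compat; lra.
have xk : x ^ k = INR n.
  rewrite -Rpower_pow; last by lra.
  by rewrite /x Rpower_mult Rmult_comm /Rdiv Rmult_1_l Rinv_r ?Rpower_1; lra.
have -> : Rpower (INR n) (1 + 1 / INR k) = INR n * x.
  by rewrite Rpower_plus Rpower_1 //; lra.
have kn0 : 0 <= INR k * INR n by apply: Rmult_le_pos; lra.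
have knx0 : 0 <= INR k * INR n * x by apply: Rmult_le_pos; lra.
rewrite /ex_lin3.
elim/big_ind: _ => [|p q hp hq|E /and3P[/forall_inP E3 /forall_inP Elin noC]].
- by rewrite /=; lra.
- by rewrite /maxn; case: ifP.
apply: Rnot_lt_le => big.
have m0 : (0 < #|E|)%nat.
  by apply/ltP/INR_lt; apply: Rle_lt_trans big; rewrite /=; lra.
(* With [p = #|E|] and [q = n] the whole vertex set has exactly the required density, so degrees
   inside [S] exceed |E|/n. *)
have [||||S [_ S0] degS] :=
  @min_degree_subset _ _ (fun e => e) E [set: 'I_n] #|E| n m0.
- by apply/set0Pn; exists (Ordinal hn); rewrite inE.
- by move=> e _; apply: subsetT.
- by move=> e /E3 /eqP ->.
- by rewrite cardsT card_ord mulnC.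
have [x0 x0S] := set0Pn _ S0.
pose F := [set e in E | e \subset S].
have FE : F \subset E by apply/subsetP => e; rewrite inE => /andP[].
have F3 e : e \in F -> #|e| = 3%nat by move/(subsetP FE)/E3/eqP.
have Flin e1 e2 u v : e1 \in F -> e2 \in F -> u != v ->
    u \in e1 -> v \in e1 -> u \in e2 -> v \in e2 -> e1 = e2.
  move=> /(subsetP FE) h1 /(subsetP FE) h2 uv u1 v1 u2 v2.
  apply/eqP; apply: contraT => ne; have /forall_inP := Elin _ h1.
  move/(_ _ h2)/implyP/(_ ne); rewrite leqNgt => /negP[].
  by apply/card_gt1P; exists u, v; rewrite !inE u1 u2 v1 v2.
have noF : ~~ has_berge_cycle (2 * k + 1) F.
  by apply: contra noC; apply: has_berge_cycle_sub.
have [lev [par [te [bfs lev0 pref]]]] := bfs_exists k F x0.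
pose d := (#|E| %/ n).+1.
have degF v : v \in S -> (d <= #|[set e in F | v \in e]|)%nat.
  move=> /degS; rewrite mulnC.
  have -> : [set e in E | (e \subset S) && (v \in e)] = [set e in F | v \in e].
    by apply/setP => e; rewrite !inE andbA.
  by rewrite -ltn_divLR.
(* Tree hyperedges belong to [F] and lie inside [S], so the degree bound holds on all levels up to
   [k]. *)
have levS i v : (i <= k)%nat -> v \in level lev i -> v \in S.
  rewrite inE => ik /eqP lv; have [l0|l0] := posnP (lev v).
    by rewrite (bfs_root bfs l0).
  have [|tF vv _ _] := @bfs_par _ _ _ _ _ _ _ bfs v; first by rewrite l0 lv.
  by move: tF; rewrite inE => /andP[_ /subsetP]; apply.
have : x ^ k < INR #|level lev k|.
  apply: (@degree_sum_growth k d x (fun i => #|level lev i|)) => //.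
  - have hm : (#|E| < d * n)%nat by exact: ltn_ceil.
    move/ltP/lt_INR: hm; rewrite mult_INR => hm.
    apply: Rlt_le; apply: (@Rmult_lt_reg_r (INR n)); first by lra.
    by apply: Rle_lt_trans hm; lra.
  - by apply/card_gt0P; exists x0; rewrite inE lev0.
  move=> i ik; apply: leq_trans (level_degree_sum F3 Flin bfs _ noF pref ik).
    rewrite mulnC -sum_nat_const; apply: leq_sum => v vi.
    by apply: degF; apply: levS vi; apply: ltnW.
  by apply: leq_trans hk.
rewrite xk; apply: Rle_not_lt; apply: le_INR; apply/leP.
by rewrite -[X in (_ <= X)%nat]card_ord max_card.
Qed.
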